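(* Let $\theta_1,\dots,\theta_k\in\Theta$, $y_1,\dots,y_k\in\Lambda$, let $\Gamma\subset C^\infty(\Theta,\Lambda)$ be a compact finite-dimensional submanifold, and let $$\mathsf{s}(\gamma)=\frac1k\sum_{l=1}^k\mathbf{dist}(y_l,\gamma(\theta_l))^2,\qquad\gamma\in\Gamma .$$ If $\gamma\in\Gamma$ is a minimiser of $\mathsf{s}$, then either $\mathsf{s}$ is differentiable at $\gamma$ and $$\mathrm{d}_\gamma\mathsf{s}=\left.-\frac2k\sum_{l=1}^k(\mathrm{d}_\gamma\mathrm{ev}_l)^*\,\log_{\gamma(\theta_l)}y_l\right|_{T_\gamma\Gamma}=0,$$ or there is an $l$ such that $\gamma(\theta_l)$ lies in the cut locus of $y_l$.
   Context: $\Theta$ is a smooth manifold and $(\Lambda,\mathbf{h})$ a Riemannian manifold with Riemannian distance function $\mathbf{dist}$. $C^\infty(\Theta,\Lambda)$ is regarded as a Fréchet manifold; tangent vectors at $\gamma$ are smooth sections of $\gamma^*T\Lambda$. The evaluation maps $\mathrm{ev}_l:\Gamma\to\Lambda$ are $\mathrm{ev}_l(\gamma)=\gamma(\theta_l)$. For $y\in\Lambda$, the cut locus of $y$ is the closed, nowhere dense set of $x$ at which $x\mapsto\mathbf{dist}(y,x)^2$ fails to be differentiable; if $x$ is not in the cut locus of $y$, then $\log_xy\in T_x\Lambda$ denotes the unique shortest tangent vector $w$ with $\exp_xw=y$ and $|w|=\mathbf{dist}(y,x)$. Tangent and cotangent spaces of $\Lambda$ are identified via $\mathbf{h}$, and the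 star denotes the transpose, so the displayed form evaluated on $v\in T_\gamma\Gamma$ is $-\frac2k\sum_l\mathbf{h}(\log_{\gamma(\theta_l)}y_l,\mathrm{d}_\gamma\mathrm{ev}_l\cdot v)$. *)

(* Defs.v *)
From HB Require Import structures.
From mathcomp Require Import all_boot all_order all_algebra.
From mathcomp Require Import all_classical all_reals all_analysis.

Set Implicit Arguments.
Unset Strict Implicit.
Unset Printing Implicit Defensive.
Import Order.TTheory GRing.Theory Num.Theory.
Import numFieldNormedType.Exports.
Local Open Scope classical_set_scope.
Local Open Scope ring_scope.

Fixpoint Ck (R : realType) (V W : normedModType R) (k : nat) (U : set V)
    (f : V -> W) : Prop :=
  match k with
  | 0%N => forall x, U x -> {for x, continuous f}
  | j.+1 => (forall x, U x -> differentiable f x) /\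
            forall v : V, Ck j U ('D_v f)
  end.

(* C^oo on the set U, which is open wherever this is used. *)
Definition smooth_on (R : realType) (V W : normedModType R) (U : set V)
    (f : V -> W) : Prop := forall k, Ck k U f.

(* chart_map and chart_inv are total functions, meaningful only on chart_dom
   and chart_cod respectively. *)
Record chart (R : realType) (M : topologicalType) (n : nat) := Chart {
  chart_dom : set M;
  chart_cod : set 'rV[R]_n;
  chart_map :> M -> 'rV[R]_n;
  chart_inv : 'rV[R]_n -> M;
  chart_dom_open : open chart_dom;
  chart_cod_open : open chart_cod;
  chart_mapP : forall x, chart_dom x -> chart_cod (chart_map x);
  chart_invP : forall z, chart_cod z -> chart_dom (chart_inv z);
  chart_mapK : forall x, chart_dom x -> chart_inv (chart_map x) = x;
  chart_invK : forall z, chart_cod z -> chart_map (chart_inv z) = z;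
  chart_map_cont : forall x, chart_dom x -> {for x, continuous chart_map};
  chart_inv_cont : forall z, chart_cod z -> {for z, continuous chart_inv} }.

(* The atlas need not be maximal.  chart_at selects a preferred chart around
   each point; it serves to represent tangent vectors. *)
Record manifold (R : realType) := Manifold {
  carrier :> topologicalType;
  mdim : nat;
  atlas : set (chart R carrier mdim);
  chart_at : carrier -> chart R carrier mdim;
  manifold_hausdorff : hausdorff_space carrier;
  manifold_second_countable : @second_countable carrier;
  chart_at_atlas : forall x, atlas (chart_at x);
  chart_at_dom : forall x, chart_dom (chart_at x) x;
  atlas_compat : forall c d, atlas c -> atlas d ->
    smooth_on [set z | chart_cod c z /\ chart_dom d (chart_inv c z)]
              (fun z => d (chart_inv c z)) }.
Arguments mdim {R} m.
Arguments atlas {R} m.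
Arguments chart_at {R m} x.

(* T_x M is R^n, a tangent vector being given by its coordinates in the
   preferred chart at x. *)
Notation tangent R M := ('rV[R]_(mdim M)).

Definition velocity (R : realType) (M : manifold R) (c : R -> M) (t : R) :
    tangent R M :=
  'D_1 (fun r => chart_at (c t) (c r)) t.

(* The coordinate vector field d/dz_i of the chart c at the point of
   coordinates z. *)
Definition coord_vec (R : realType) (M : manifold R) (c : chart R M (mdim M))
    (z : 'rV[R]_(mdim M)) (i : 'I_(mdim M)) : tangent R M :=
  'D_(delta_mx 0 i) (fun z' => chart_at (chart_inv c z) (chart_inv c z')) z.

Definition mdifferentiable (R : realType) (M : manifold R) (f : M -> R)
    (x : M) : Prop :=
  differentiable (fun z => f (chart_inv (chart_at x) z)) (chart_at x x).

Definition metric_form (R : realType) (n : nat) (G : 'M[R]_n)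
    (v w : 'rV[R]_n) : R := (v *m G *m w^T) 0 0.

Definition gram_in (R : realType) (M : manifold R) (G : M -> 'M[R]_(mdim M))
    (c : chart R M (mdim M)) (z : 'rV[R]_(mdim M)) : 'M[R]_(mdim M) :=
  \matrix_(i, j) metric_form (G (chart_inv c z)) (coord_vec c z i)
                                                (coord_vec c z j).

(* metric_mx x is the matrix of the inner product on T_x M in the preferred
   chart at x, so that smoothness has to be asked in each chart c of the
   atlas, for the Gram matrix of the coordinate fields of c. *)
Record riemannian (R : realType) (M : manifold R) := Riemannian {
  metric_mx : M -> 'M[R]_(mdim M);
  metric_sym : forall x, (metric_mx x)^T = metric_mx x;
  metric_pos : forall x v, v != 0 -> 0 < metric_form (metric_mx x) v v;
  metric_smooth : forall c, atlas M c -> forall i j,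
    smooth_on (chart_cod c) (fun z => gram_in metric_mx c z i j) }.

Section Riemannian.
Variables (R : realType) (M : manifold R) (h : riemannian M).
Implicit Types (x y : M) (c : chart R M (mdim M)) (g : R -> M).

Definition inner x (v w : tangent R M) : R := metric_form (metric_mx h x) v w.

Definition tnorm x (v : tangent R M) : R := Num.sqrt (inner x v v).

Definition C1_arc g : Prop := exists2 e : R, 0 < e &
  forall t, - e < t < 1 + e ->
    {for t, continuous g} /\
    forall c, atlas M c -> chart_dom c (g t) ->
      derivable (fun r => c (g r)) t 1 /\
      {for t, continuous ('D_1 (fun r => c (g r)))}.

Definition arc_length g : R :=
  \int[lebesgue_measure]_(t in `[0, 1]) tnorm (g t) (velocity g t).

(* A piecewise C^1 curve is a finite chain of C^1 arcs, each parametrised by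
   [0, 1]; its length is the sum of theirs. *)
Inductive joined_by_length : M -> M -> R -> Prop :=
| joined_refl x : joined_by_length x x 0
| joined_arc x z y g l : C1_arc g -> g 0 = x -> g 1 = z ->
    joined_by_length z y l -> joined_by_length x y (arc_length g + l).

Definition dist x y : R := inf [set l | joined_by_length x y l].

Definition cut_locus y : set M :=
  [set x | ~ mdifferentiable (fun x' => dist y x' ^+ 2) x].

Definition christoffel c (z : 'rV[R]_(mdim M)) (k i j : 'I_(mdim M)) : R :=
  let G := gram_in (metric_mx h) c in
  let dG a b l := 'D_(delta_mx 0 a) (fun z' => G z' b l) z in
  2^-1 * \sum_l invmx (G z) k l * (dG i j l + dG j i l - dG l i j).

Definition geodesic_at g (t : R) : Prop :=
  {for t, continuous g} /\
  forall c, atlas M c -> chart_dom c (g t) ->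
    let u := fun r => c (g r) in
    let u' := 'D_1 u in
    [/\ derivable u t 1, derivable u' t 1 &
        forall k, ('D_1 u' t) 0 k +
          \sum_i \sum_j christoffel c (u t) k i j * u' t 0 i * u' t 0 j = 0].

(* exp_x w = y.  A relation, as exp_x may be defined only on a part of T_x M. *)
Definition exp_eq x (w : tangent R M) y : Prop :=
  exists g : R -> M,
    (exists2 e : R, 0 < e & forall t, - e < t < 1 + e -> geodesic_at g t) /\
    [/\ g 0 = x, velocity g 0 = w & g 1 = y].

Definition shortest x y (w : tangent R M) : Prop :=
  exp_eq x w y /\ tnorm x w = dist y x.

(* The unique w with exp_x w = y and |w| = dist (y, x); the value 0 is used
   when there is no such unique vector. *)
Definition log x y : tangent R M :=
  xget 0 [set w | shortest x y w /\ forall w', shortest x y w' -> w' = w].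

(* The convention under which log_x y is meaningful off the cut locus: a
   shortest tangent vector exists.  By Hopf-Rinow it holds whenever M is
   complete and connected; it fails e.g. for a punctured plane.  Uniqueness
   is not part of it. *)
Definition shortest_exist : Prop :=
  forall y x, ~ cut_locus y x -> exists w, shortest x y w.

End Riemannian.

Definition smooth_map (R : realType) (M N : manifold R) (f : M -> N) : Prop :=
  continuous f /\
  forall c d, atlas M c -> atlas N d ->
    smooth_on [set z | chart_cod c z /\ chart_dom d (f (chart_inv c z))]
              (fun z => d (f (chart_inv c z))).

Record smoothMap (R : realType) (M N : manifold R) := SmoothMap {
  smap :> M -> N;
  smapP : smooth_map smap }.

HB.instance Definition _ (R : realType) (M N : manifold R) :=
  gen_eqMixin (smoothMap M N).
HB.instance Definition _ (R : realType) (M N : manifold R) :=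
  gen_choiceMixin (smoothMap M N).

Definition iter_derive (R : realType) (V W : normedModType R) (vs : seq V)
    (f : V -> W) : V -> W := foldr (fun v g => 'D_v g) f vs.

(* Subbase of the (weak) C^oo topology: on a compact subset K of a chart
   domain, the iterated directional derivative along vs is e-close to that
   of f. *)
Definition whitney_nbhd (R : realType) (M N : manifold R) (f : smoothMap M N)
    (c : chart R M (mdim M)) (d : chart R N (mdim N)) (K : set M)
    (vs : seq 'rV[R]_(mdim M)) (e : R) : set (smoothMap M N) :=
  [set g | forall x, K x -> chart_dom d (g x) /\
     `| iter_derive vs (fun z => d (g (chart_inv c z))) (c x)
        - iter_derive vs (fun z => d (f (chart_inv c z))) (c x) | < e].

Definition whitney_subbase (R : realType) (M N : manifold R) :
    set (set (smoothMap M N)) :=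
  [set A | exists f c d K vs e,
     [/\ atlas M c, atlas N d, compact K, K `<=` chart_dom c &
         forall x, K x -> chart_dom d (smap f x)] /\
     (0 < e /\ A = whitney_nbhd f c d K vs e)].

HB.instance Definition _ (R : realType) (M N : manifold R) :=
  isSubBaseTopological.Build (smoothMap M N) (@whitney_subbase R M N) id.

Section Submanifolds.
Variables (R : realType) (M N : manifold R) (m : nat).
Implicit Types (U : set 'rV[R]_m) (phi : 'rV[R]_m -> smoothMap M N)
  (G : set (smoothMap M N)) (gam : smoothMap M N).

(* Smoothness of a map from an open U in R^m to C^oo(M, N) is joint smoothness
   of (u, x) |-> phi u x (exponential law). *)
Definition smooth_family U phi : Prop :=
  (forall u x, U u -> {for (u, x), continuous (fun p => phi p.1 p.2)}) /\
  forall c d, atlas M c -> atlas N d ->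
    smooth_on [set p : 'rV[R]_m * 'rV[R]_(mdim M) |
                [/\ U p.1, chart_cod c p.2 &
                    chart_dom d (phi p.1 (chart_inv c p.2))]]
              (fun p => d (phi p.1 (chart_inv c p.2))).

(* The tangent vector at phi u that is the image of a under the differential
   of phi at u: the section of (phi u)^* TN whose value at x is the velocity
   of t |-> phi (u + t a) x. *)
Definition family_diff phi (u a : 'rV[R]_m) : M -> tangent R N :=
  fun x => velocity (fun t => phi (u + t *: a) x) 0.

(* phi is a smooth embedding of the open set U onto a relatively open subset
   of G, with phi u = gam. *)
Definition local_param G gam U phi (u : 'rV[R]_m) : Prop :=
  [/\ open U, U u & phi u = gam] /\
  [/\ smooth_family U phi,
      forall u', U u' -> {for u', continuous phi},
      forall u1 u2, U u1 -> U u2 -> phi u1 = phi u2 -> u1 = u2,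
      forall u' a, U u' -> family_diff phi u' a = (fun=> 0) -> a = 0 &
      forall W, open W -> W `<=` U ->
        exists2 O, open O & phi @` W = G `&` O].

Definition submanifold G : Prop :=
  forall gam, G gam -> exists U phi u, local_param G gam U phi u.

Definition tangent_space G gam : set (M -> tangent R N) :=
  [set v | exists U phi u a,
     local_param G gam U phi u /\ v = family_diff phi u a].

(* s is differentiable at gam along G, and its differential at gam is the
   restriction of omega to the tangent space of G at gam. *)
Definition has_differential G (s : smoothMap M N -> R) gam
    (omega : (M -> tangent R N) -> R) : Prop :=
  forall U phi u, local_param G gam U phi u ->
    differentiable (fun u' => s (phi u')) u /\
    forall a, 'd (fun u' => s (phi u')) u a = omega (family_diff phi u a).

End Submanifolds.

Section Functional.
Variables (R : realType) (Theta Lambda : manifold R) (h : riemannian Lambda).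
Variables (k : nat) (theta : 'I_k -> Theta) (y : 'I_k -> Lambda).

Definition ev (t : Theta) (gam : smoothMap Theta Lambda) : Lambda := gam t.

Definition dev (t : Theta) (v : Theta -> tangent R Lambda) : tangent R Lambda :=
  v t.

(* (d_gam ev_t)^* w, for w in the tangent space at gam t, as a form. *)
Definition dev_adj (gam : smoothMap Theta Lambda) (t : Theta)
    (w : tangent R Lambda) (v : Theta -> tangent R Lambda) : R :=
  inner h (ev t gam) w (dev t v).

Definition mean_sq_dist (gam : smoothMap Theta Lambda) : R :=
  k%:R^-1 * \sum_(l < k) dist h (y l) (ev (theta l) gam) ^+ 2.

Definition mean_sq_dist_form (gam : smoothMap Theta Lambda)
    (v : Theta -> tangent R Lambda) : R :=
  - (2 / k%:R) * \sum_(l < k)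
     dev_adj gam (theta l) (log h (ev (theta l) gam) (y l)) v.

End Functional.

(* Main.v *)
(* Off the cut locus, f = dist(y, .)^2 is differentiable at x by definition, so
   only its differential has to be identified.  Let g be a geodesic from x to y
   with velocity w at x and |w| = dist(y, x); it has constant speed.  For small
   s > 0 join the point x_s with coordinates x + s v to g(s) by a straight
   segment in a chart and follow g from g(s) to y.  Since
   ((1 - s) a + s b)^2 <= (1 - s) a^2 + s b^2, this gives
   f(x_s) <= (1 - s) |w|^2 + s |v - w|^2 + o(s), hence
   df(v) <= |v|^2 - 2 <w, v>.  Replacing v by its multiples gives
   df(v) = - 2 <w, v>.  No variation of the whole geodesic is needed, and w is
   unique because the metric is nondegenerate, so w = log_x y.  The chain rule
   along a local parametrisation of Gamma and the vanishing of the differential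
   at a minimum conclude. *)
Require Import Defs.
From mathcomp Require Import all_boot all_order all_algebra.
From mathcomp Require Import all_classical all_reals all_analysis.
From mathcomp Require Import ring lra.
Import Order.TTheory GRing.Theory Num.Theory.
Import numFieldNormedType.Exports.
Local Open Scope classical_set_scope.
Local Open Scope ring_scope.
Set Implicit Arguments.
Unset Strict Implicit.

(** * Integral bounds over the unit interval *)

(* No measurability is required: the integral of a nonnegative function is a
   supremum over the simple functions below it. *)
Lemma Rintegral01_le (R : realType) (f : R -> R) (B : R) :
  (forall x, 0 <= x <= 1 -> 0 <= f x <= B) ->
  \int[lebesgue_measure]_(x in `[0, 1]) f x <= B.
Proof.
move=> fB.
have mem01 x : (`[0, 1]%classic : set R) x -> 0 <= x <= 1 by rewrite /= in_itv.
have B0 : 0 <= B.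
  have /andP[f0 f0B] : 0 <= f 0 <= B by apply: fB; rewrite lexx ler01.
  exact: le_trans f0B.
have cstB : (\int[lebesgue_measure]_(x in `[0%R, 1%R]) (cst B%:E) x = B%:E :> \bar R)%E.
  rewrite integral_cst//= lebesgue_measure_itv/= lte_fin ltr01.
  by rewrite oppr0 adde0 mule1.
suff le_int : (\int[lebesgue_measure]_(x in `[0%R, 1%R]) (f x)%:E <= B%:E)%E.
  rewrite /Rintegral.
  have int_ge0 : (0 <= \int[lebesgue_measure]_(x in `[0%R, 1%R]) (f x)%:E)%E.
    by apply: integral_ge0 => x /mem01/fB/andP[? _]; rewrite lee_fin.
  (* Lying between 0 and [B], the extended integral is a real number, so the passage to its real
     value loses nothing. *)
  by move: le_int int_ge0; case: integral => // r; rewrite !lee_fin.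
rewrite -cstB !ge0_integralE; last 2 first.
- by move=> x _; rewrite lee_fin.
- by move=> x /mem01/fB/andP[? _]; rewrite lee_fin.
apply: le_ereal_sup => _ [h hf <-]; exists h => // x.
apply: (le_trans (hf x)); rewrite /patch; case: ifPn => //.
by rewrite inE => /mem01/fB/andP[_ ?]; rewrite lee_fin.
Qed.

Lemma Rintegral01_cst (R : realType) (f : R -> R) (B : R) :
  (forall x, 0 <= x <= 1 -> f x = B) ->
  \int[lebesgue_measure]_(x in `[0, 1]) f x = B.
Proof.
move=> fB; rewrite (@eq_Rintegral _ _ _ _ _ (cst B)); last first.
  by move=> x; rewrite inE /= in_itv /= => /fB.
by rewrite Rintegral_cst//= lebesgue_measure_itv/= lte_fin ltr01 oppr0 addr0 mulr1.
Qed.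

(** * Differential calculus in normed spaces *)

(** The difference quotients from the right are eventually at most [B], hence so is their limit.
    This turns a bound by comparison curves into a bound on the differential. *)
Lemma diff_le_right (R : realType) (V : normedModType R) (f : V -> R)
    (p a : V) (B : R) : differentiable f p ->
  (\forall t \near 0^'+, f (p + t *: a) <= f p + t * B) -> 'd f p a <= B.
Proof.
move=> df le_f; rewrite -deriveE//.
have /cvg_ex[l fl] := diff_derivable (v := a) df.
have -> : 'D_a f p = l by apply: cvg_lim.
apply: (cvgr_to_le (cvg_dnbhs_at_right fl)) => /=.
near=> t.
have t0 : 0 < t by near: t; exact: nbhs_right_gt.
rewrite -[_ *: _]/(_ * _) ler_pdivrMl// lerBlDl (addrC (t *: a)).
by near: t.
Unshelve. all: by end_near. Qed.

(** The one-sided bound, applied to [- f], makes the differential nonnegative in every direction;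
    the directions [a] and [- a] together give zero. *)
Lemma diff_local_min (R : realType) (V : normedModType R) (f : V -> R)
    (p a : V) : differentiable f p ->
  (\forall x \near p, f p <= f x) -> 'd f p a = 0.
Proof.
move=> df fmin.
suff le0 b : 0 <= 'd f p b.
  by apply/eqP; rewrite eq_le le0 andbT -oppr_ge0 -linearN le0.
rewrite -oppr_le0; have <- : 'd (- f) p b = - 'd f p b by rewrite diffN.
apply: diff_le_right; first exact: differentiableN.
have cv : (p + t *: b) @[t --> 0^'+] --> p.
  rewrite -[X in _ --> X]addr0 -(scale0r b); apply: cvg_at_right_filter.
  by apply: cvgD; [exact: cvg_cst|exact: scalel_continuous].
near=> t; rewrite mulr0 addr0 lerN2; near: t.
exact: (cv _ fmin).
Unshelve. all: by end_near. Qed.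

Section CurveChain.
Variables (R : realType) (V W : normedModType R) (F : V -> W) (u : R -> V).

Lemma derivable_comp_curve t : differentiable F (u t) -> derivable u t 1 ->
  derivable (F \o u) t 1.
Proof.
by move=> dF /derivable1_diffP du; apply/derivable1_diffP/differentiable_comp.
Qed.

Lemma derive_comp_curve t : differentiable F (u t) -> derivable u t 1 ->
  'D_1 (F \o u) t = 'd F (u t) ('D_1 u t).
Proof.
move=> dF /derivable1_diffP du.
by rewrite !deriveE//; [rewrite diff_comp|exact: differentiable_comp].
Qed.

End CurveChain.

Lemma diff_rowE (R : realType) (n : nat) (W : normedModType R)
    (F : 'rV[R]_n -> W) (z v : 'rV[R]_n) : differentiable F z ->
  'd F z v = \sum_i v 0 i *: 'D_(delta_mx 0 i) F z.
Proof.
move=> dF; rewrite {1}(row_sum_delta v) linear_sum.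
by apply: eq_bigr => i _; rewrite linearZ deriveE.
Qed.

(** Near [z] the composite of [g] after [f] is the identity, so by the chain rule [v] is the image
    of ['d f z v] under a linear map. *)
Lemma diff_left_inverse_eq0 (R : realType) (V W : normedModType R)
    (f : V -> W) (g : W -> V) (z v : V) :
  differentiable f z -> differentiable g (f z) ->
  (\forall x \near z, g (f x) = x) -> 'd f z v = 0 -> v = 0.
Proof.
move=> df dg gf fv0.
have <- : 'D_v (g \o f) z = v.
  by rewrite -[RHS](derive_id z); apply: near_eq_derive; exact: gf.
rewrite deriveE; last exact: differentiable_comp.
by rewrite diff_comp// [LHS]/= fv0 linear0.
Qed.

Section SmoothOn.
Variables (R : realType) (V W : normedModType R) (U : set V) (f : V -> W).

Lemma smooth_on_differentiable x : smooth_on U f -> U x -> differentiable f x.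
Proof. by move=> /(_ 1%N)[+ _]; apply. Qed.

Lemma smooth_on_derive_continuous v x : smooth_on U f -> U x ->
  {for x, continuous ('D_v f)}.
Proof. by move=> /(_ 1%N)[_ +]; apply. Qed.

End SmoothOn.

(** * Charts, transition maps and coordinate frames *)

Section Charts.
Variables (R : realType) (M : manifold R).
Implicit Types (c d : chart R M (mdim M)) (z : 'rV[R]_(mdim M)).

Lemma chart_near c x : chart_dom c x -> \forall x' \near x, chart_dom c x'.
Proof. by move=> cx; apply: open_nbhs_nbhs; split=> //; exact: chart_dom_open. Qed.

Lemma chart_cod_near c z : chart_cod c z -> \forall z' \near z, chart_cod c z'.
Proof. by move=> cz; apply: open_nbhs_nbhs; split=> //; exact: chart_cod_open. Qed.

Lemma transition_differentiable c d z : atlas M c -> atlas M d ->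
  chart_cod c z -> chart_dom d (chart_inv c z) ->
  differentiable (fun z' => d (chart_inv c z')) z.
Proof. by move=> Ac Ad cz dz; apply: smooth_on_differentiable (atlas_compat Ac Ad) _. Qed.

(** The transposed Jacobian of the transition to the preferred chart: right multiplication turns
    components in [c] into preferred components. *)
Definition coord_mx c z : 'M[R]_(mdim M) := \matrix_i coord_vec c z i.

Lemma gram_formE (G : M -> 'M[R]_(mdim M)) c z v w :
  metric_form (gram_in G c z) v w =
  metric_form (G (chart_inv c z)) (v *m coord_mx c z) (w *m coord_mx c z).
Proof.
have -> : gram_in G c z = coord_mx c z *m G (chart_inv c z) *m (coord_mx c z)^T.
  apply/matrixP => i j; rewrite mxE /metric_form.
  have rowE k : coord_vec c z k = row k (coord_mx c z) by rewrite rowK.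
  by rewrite !rowE -row_mul tr_row !mxE; apply: eq_bigr => l _; rewrite !mxE.
by rewrite /metric_form trmx_mul !mulmxA.
Qed.

Lemma diff_chart_at c z v : atlas M c -> chart_cod c z ->
  'd (fun z' => chart_at (chart_inv c z) (chart_inv c z')) z v =
  v *m coord_mx c z.
Proof.
move=> Ac cz; rewrite diff_rowE ?mulmx_sum_row; last first.
  apply: transition_differentiable => //; first exact: chart_at_atlas.
  exact: chart_at_dom.
by apply: eq_bigr => i _; rewrite rowK.
Qed.

(** By continuity [g] stays in the domain of [c] near [t], so its preferred coordinates are the
    transition map applied to [c (g r)]; the rest is the chain rule. *)
Lemma velocity_chart c (g : R -> M) t : atlas M c -> chart_dom c (g t) ->
  {for t, continuous g} -> derivable (fun r => c (g r)) t 1 ->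
  velocity g t = 'D_1 (fun r => c (g r)) t *m coord_mx c (c (g t)).
Proof.
move=> Ac cg g_cont du.
rewrite -diff_chart_at//; last exact: chart_mapP.
rewrite chart_mapK// -(@derive_comp_curve _ _ _ _ (fun r => c (g r)))//.
  apply: near_eq_derive; near=> r => /=; rewrite chart_mapK//; near: r.
  by apply: g_cont; exact: chart_near.
apply: transition_differentiable => //; [exact: chart_at_atlas|exact: chart_mapP|].
by rewrite chart_mapK//; exact: chart_at_dom.
Unshelve. all: by end_near. Qed.

(** Each row of the left kernel is annihilated by the differential of a transition map, and the
    reverse transition is a differentiable left inverse of that map. *)
Lemma coord_mx_unit c z : atlas M c -> chart_cod c z -> coord_mx c z \in unitmx.
Proof.
move=> Ac cz; rewrite -row_free_unit -kermx_eq0; apply/eqP/row_matrixP => i.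
rewrite row0; set v := row i _.
have vC : v *m coord_mx c z = 0 by apply/sub_kermxP; exact: row_sub.
set d := chart_at (chart_inv c z) : chart R M (mdim M).
have Ad : atlas M d by exact: chart_at_atlas.
have dz : chart_dom d (chart_inv c z) by exact: chart_at_dom.
have dtau : differentiable (fun z' => d (chart_inv c z')) z.
  exact: transition_differentiable.
have dsig : differentiable (fun z' => c (chart_inv d z')) (d (chart_inv c z)).
  apply: transition_differentiable => //; first exact: chart_mapP.
  by rewrite chart_mapK//; exact: chart_invP.
apply: (diff_left_inverse_eq0 dtau dsig); last first.
  by have := @diff_chart_at c z v Ac cz; rewrite vC.
near=> z' => /=.
have cz' : chart_cod c z' by near: z'; exact: chart_cod_near.
rewrite chart_mapK ?chart_invK//; near: z'.
by apply: (chart_inv_cont cz); exact: chart_near.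
Unshelve. all: by end_near. Qed.

Lemma coord_mx_preferred (x : M) : coord_mx (chart_at x) (chart_at x x) = 1%:M.
Proof.
apply/row_matrixP => i; rewrite rowK row1 /coord_vec.
have xx := chart_at_dom x; rewrite chart_mapK//.
rewrite -[RHS](derive_id (chart_at x x)); apply: near_eq_derive.
near=> z => /=; rewrite chart_invK//; near: z.
by apply: chart_cod_near; exact: chart_mapP.
Unshelve. all: by end_near. Qed.

End Charts.

(** * The distance and geodesics *)

Lemma metric_formE (R : realType) n (G : 'M[R]_n) (v w : 'rV[R]_n) :
  metric_form G v w = \sum_i \sum_j v 0 i * G i j * w 0 j.
Proof.
rewrite /metric_form !mxE exchange_big; apply: eq_bigr => j _ /=.
by rewrite !mxE mulr_suml.
Qed.

Lemma metric_formC (R : realType) n (G : 'M[R]_n) (v w : 'rV[R]_n) :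
  G^T = G -> metric_form G v w = metric_form G w v.
Proof.
move=> Gsym; rewrite /metric_form -{1}Gsym.
rewrite (_ : v *m _ *m _ = (w *m G *m v^T)^T); first by rewrite mxE.
by rewrite !trmx_mul trmxK mulmxA.
Qed.

(* [D l i j] stands for the partial derivative of [G i j] in direction [l]. *)
Lemma geodesic_energy (R : realType) n (G : 'M[R]_n) (v a : 'rV[R]_n)
    (D : 'I_n -> 'I_n -> 'I_n -> R) : G^T = G -> G \in unitmx ->
  (forall k, a 0 k + \sum_i \sum_j
     (2^-1 * \sum_l invmx G k l * (D i j l + D j i l - D l i j)) *
       v 0 i * v 0 j = 0) ->
  \sum_i \sum_j v 0 i * (\sum_l v 0 l * D l i j) * v 0 j
    + 2 * metric_form G v a = 0.
Proof.
move=> Gsym Gunit geo.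
(* The left-hand side of the goal is the derivative of G(v, v) along a curve with velocity [v] and
   acceleration [a]. *)
pose q : 'cV[R]_n :=
  \col_l \sum_i \sum_j (D i j l + D j i l - D l i j) * v 0 i * v 0 j.
(* The geodesic equation solved for the acceleration; 1/2 and the inverse of [G] come from the
   Christoffel symbols. *)
have aE : a^T = - (2^-1 *: (invmx G *m q)).
  apply/colP => k; rewrite !mxE; apply/eqP; rewrite -addr_eq0; apply/eqP.
  rewrite -[RHS](geo k); congr (_ + _).
  rewrite mulr_sumr.
  under eq_bigr do rewrite mxE mulr_sumr mulr_sumr.
  rewrite exchange_big; apply: eq_bigr => i _.
  under eq_bigr do rewrite mulr_sumr mulr_sumr.
  rewrite exchange_big; apply: eq_bigr => j _.
  rewrite mulr_sumr !mulr_suml; apply: eq_bigr => l _; ring.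
(* Contracted with the symmetric product of three copies of [v], every index permutation of [D]
   gives the same cubic sum [T]; the Christoffel bracket leaves T + T - T. *)
pose T := \sum_l \sum_i \sum_j v 0 l * D l i j * v 0 i * v 0 j.
have formE : metric_form G v a = - (2^-1 * (v *m q) 0 0).
  rewrite /metric_form aE mulmxN -scalemxAr mulmxA -(mulmxA v G) mulmxV//.
  by rewrite mulmx1 !mxE.
have vqE : (v *m q) 0 0 = T.
  have -> : (v *m q) 0 0 = \sum_l \sum_i \sum_j (v 0 l * D i j l * v 0 i * v 0 j)
     + \sum_l \sum_i \sum_j (v 0 l * D j i l * v 0 i * v 0 j) - T.
    rewrite mxE -big_split -sumrB; apply: eq_bigr => l _ /=.
    rewrite mxE mulr_sumr -big_split -sumrB; apply: eq_bigr => i _ /=.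
    rewrite mulr_sumr -big_split -sumrB; apply: eq_bigr => j _ /=; ring.
  have -> : \sum_l \sum_i \sum_j (v 0 l * D i j l * v 0 i * v 0 j) = T.
    rewrite exchange_big; apply: eq_bigr => i _ /=.
    by rewrite exchange_big; do 2!apply: eq_bigr => ? _ /=; ring.
  have -> : \sum_l \sum_i \sum_j (v 0 l * D j i l * v 0 i * v 0 j) = T.
    under eq_bigr do rewrite exchange_big.
    rewrite exchange_big; apply: eq_bigr => i _ /=.
    by rewrite exchange_big; do 2!apply: eq_bigr => ? _ /=; ring.
  by rewrite addrK.
rewrite formE vqE.
have -> : \sum_i \sum_j v 0 i * (\sum_l v 0 l * D l i j) * v 0 j = T.
  rewrite /T [RHS]exchange_big; apply: eq_bigr => i _ /=.
  rewrite [RHS]exchange_big; apply: eq_bigr => j _ /=.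
  rewrite mulr_sumr mulr_suml; apply: eq_bigr => l _; ring.
by field.
Qed.

Lemma near_itv (R : realType) (a b t : R) : a < t < b ->
  \forall r \near t, a < r < b.
Proof.
move=> tab; have : t \in `]a, b[ by rewrite in_itv.
by move=> /near_in_itvoo; apply: filterS => r; rewrite in_itv.
Qed.

Section Distance.
Variables (R : realType) (M : manifold R) (h : riemannian M).
Implicit Types (x y : M) (g : R -> M) (c : chart R M (mdim M)).

Lemma tnorm_ge0 x v : 0 <= tnorm h x v.
Proof. exact: sqrtr_ge0. Qed.

Lemma inner_ge0 x v : 0 <= inner h x v v.
Proof.
have [->|/(metric_pos h x)/ltW//] := eqVneq v 0.
by rewrite /inner metric_formE big1// => i _; rewrite big1// => j _; rewrite mxE !mul0r.
Qed.

Lemma innerC x v w : inner h x v w = inner h x w v.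
Proof. exact: metric_formC (Defs.metric_sym h x). Qed.

Lemma tnorm_sqr x v : tnorm h x v ^+ 2 = inner h x v v.
Proof. by rewrite sqr_sqrtr// inner_ge0. Qed.

Lemma joined_ge0 x y l : joined_by_length h x y l -> 0 <= l.
Proof.
elim=> {x y l} [//|x z y g l _ _ _ _ l0]; rewrite addr_ge0// Rintegral_ge0//.
by move=> t _; exact: tnorm_ge0.
Qed.

Lemma dist_ge0 x y : 0 <= dist h x y.
Proof.
rewrite /dist; set S := [set _ | _].
(* If no curve joins [x] to [y], the set is empty and [inf] has the default value 0. *)
have [->|/set0P S0] := eqVneq S set0; first by rewrite inf0.
by apply: lb_le_inf => // l /joined_ge0.
Qed.

Lemma dist_le x y l : joined_by_length h x y l -> dist h x y <= l.
Proof. by move=> ?; apply: ge_inf => //; exists 0 => ? /joined_ge0. Qed.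

(** A null vector of the Gram matrix would yield, through the invertible [coord_mx], a nonzero
    tangent vector of length zero. *)
Lemma gram_unit c z : atlas M c -> chart_cod c z ->
  gram_in (metric_mx h) c z \in unitmx.
Proof.
move=> Ac cz; rewrite unitmxE unitfE; apply/negP => /det0P[v v0 vG].
have vC0 : v *m coord_mx c z != 0.
  by apply: contra_neq v0 => vC; rewrite -[v](mulmxK (coord_mx_unit Ac cz)) vC mul0mx.
have := metric_pos h (chart_inv c z) vC0.
by rewrite -gram_formE /metric_form vG mul0mx mxE ltxx.
Qed.

Lemma gram_sym c z :
  (gram_in (metric_mx h) c z)^T = gram_in (metric_mx h) c z.
Proof.
by apply/matrixP => i j; rewrite !mxE; exact: (metric_formC _ _ (Defs.metric_sym h _)).
Qed.

Lemma inner_velocity c g t : atlas M c -> chart_dom c (g t) ->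
  {for t, continuous g} -> derivable (fun r => c (g r)) t 1 ->
  inner h (g t) (velocity g t) (velocity g t) =
  metric_form (gram_in (metric_mx h) c (c (g t)))
    ('D_1 (fun r => c (g r)) t) ('D_1 (fun r => c (g r)) t).
Proof.
by move=> Ac cg gc du; rewrite (velocity_chart Ac)// gram_formE chart_mapK.
Qed.

(** In a fixed chart around [g t] the squared speed is a quadratic form in the coordinate velocity;
    the geodesic equation cancels its derivative by [geodesic_energy]. *)
Lemma geodesic_speed_derive g (e t : R) :
  (forall r, - e < r < 1 + e -> geodesic_at h g r) -> - e < t < 1 + e ->
  is_derive t 1 (fun r => inner h (g r) (velocity g r) (velocity g r)) 0.
Proof.
move=> geo te; have [g_cont geoc] := geo _ te.
set c := chart_at (g t) : chart R M (mdim M).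
have Ac : atlas M c by exact: chart_at_atlas.
have cg : chart_dom c (g t) by exact: chart_at_dom.
pose u r := c (g r); pose u' := 'D_1 u; pose G := gram_in (metric_mx h) c.
have [du du' geoE] := geoc c Ac cg.
pose E r := \sum_i \sum_j u' r 0 i * G (u r) i j * u' r 0 j.
have cz : chart_cod c (u t) by exact: chart_mapP.
(* The preferred chart at [g r] varies with [r]; near [t] the speed is rewritten in the single chart
   [c]. *)
apply: (@near_eq_is_derive _ _ _ E).
  near=> r.
  have cgr : chart_dom c (g r) by near: r; apply: g_cont; exact: chart_near.
  have [|gr_cont /(_ c Ac cgr)[dur _ _]] := geo r _.
    by near: r; exact: near_itv.
  by rewrite (inner_velocity Ac cgr gr_cont dur) metric_formE.
have du'i i : is_derive t 1 (fun r => u' r 0 i) ('D_1 u' t 0 i).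
  have := (derivable_mxP u' t 1).1 du' 0 i => /derivableP.
  by rewrite (derive_mx du') mxE.
have dG i j : is_derive t 1 (fun r => G (u r) i j)
    (\sum_l u' t 0 l * 'D_(delta_mx 0 l) (fun z => G z i j) (u t)).
  have dGz : differentiable (fun z => G z i j) (u t).
    by apply: smooth_on_differentiable cz; exact: metric_smooth.
  have dGu := derivable_comp_curve dGz du.
  by split => //; rewrite (derive_comp_curve dGz du) diff_rowE.
have Gsym : (G (u t))^T = G (u t) by exact: gram_sym.
have := geodesic_energy Gsym (gram_unit Ac cz) geoE.
move=> E0.
have dE : is_derive t 1 (\sum_i \sum_j (fun r => u' r 0 i * G (u r) i j * u' r 0 j))
   (\sum_i \sum_j
     ((u' t 0 i * G (u t) i j) * 'D_1 u' t 0 j +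
       u' t 0 j * (u' t 0 i * (\sum_l u' t 0 l * 'D_(delta_mx 0 l) (fun z => G z i j) (u t))
        + G (u t) i j * 'D_1 u' t 0 i))).
  apply: is_derive_sum => i; apply: is_derive_sum => j.
  exact: (is_deriveM (is_deriveM (du'i i) (dG i j)) (du'i j)).
have -> : E = \sum_i \sum_j (fun r => u' r 0 i * G (u r) i j * u' r 0 j).
  by apply/funext => r; rewrite fct_sumE; apply: eq_bigr => i _; rewrite fct_sumE.
rewrite -E0; apply: is_derive_eq dE _.
(* By symmetry of the metric, 2 G(u', u'') splits as G(u', u'') + G(u'', u'), matching the two
   acceleration terms of the product rule. *)
rewrite mulr2n mulrDl mul1r {2}(metric_formC _ _ Gsym) !metric_formE.
rewrite -!big_split; apply: eq_bigr => i _ /=.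
rewrite -!big_split; apply: eq_bigr => j _ /=.
rewrite /u'; ring.
Unshelve. all: by end_near. Qed.

End Distance.

(** * Arcs of class C^1 *)

Section Affine.
Variables (R : realType) (W : normedModType R).

Lemma derivable_affine (F : R -> W) (a b r : R) : derivable F (a + b * r) 1 ->
  derivable (fun r' => F (a + b * r')) r 1.
Proof.
move=> dF; apply: (@derivable_comp_curve _ _ _ F (fun r' => a + b * r')).
  exact/derivable1_diffP.
by apply: derivableD => //; apply: derivableM.
Qed.

Lemma derive_affine (F : R -> W) (a b r : R) : derivable F (a + b * r) 1 ->
  'D_1 (fun r' => F (a + b * r')) r = b *: 'D_1 F (a + b * r).
Proof.
move=> dF; have dF' := (derivable1_diffP F (a + b * r)).1 dF.
have drho : is_derive r 1 (fun r' => a + b * r') b.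
  apply: is_derive_eq (is_deriveD (is_derive_cst a r 1)
    (is_deriveM (is_derive_cst b r 1) (is_derive_id r 1))) _.
  by rewrite /= !scaler0 addr0 add0r; exact: mulr1.
rewrite (@derive_comp_curve _ _ _ F (fun r' => a + b * r'))//.
by rewrite (diff1E dF') derive1E derive_val.
Qed.

Lemma affine_continuous (a b r : R) : {for r, continuous (fun r' => a + b * r')}.
Proof.
apply: differentiable_continuous; apply/derivable1_diffP.
by apply: derivableD => //; apply: derivableM.
Qed.

Lemma derive_affine_continuous (F : R -> W) (a b t : R) :
  (\forall r \near t, derivable F (a + b * r) 1) ->
  {for a + b * t, continuous ('D_1 F)} ->
  {for t, continuous ('D_1 (fun r => F (a + b * r)))}.
Proof.
move=> dF F_cont.
have nearE : \forall r \near t, b *: 'D_1 F (a + b * r)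
    = 'D_1 (fun r => F (a + b * r)) r.
  by near=> r; rewrite derive_affine//; near: r.
rewrite /prop_for /continuous_at -(nbhs_singleton nearE).
apply: cvg_trans; first exact: (near_eq_cvg nearE).
apply: cvgZ; first exact: cvg_cst.
apply: (@continuous_comp _ _ _ (fun r => a + b * r) ('D_1 F)) => //.
exact: affine_continuous.
Unshelve. all: by end_near. Qed.

Lemma is_derive_line (z d : W) (r : R) : is_derive r 1 (fun r' => z + r' *: d) d.
Proof.
have dl : is_derive r 1 ( *:%R^~ d) d.
  split; first exact: diff_derivable.
  by rewrite deriveE// diff_val scale1r.
by have := is_deriveD (is_derive_cst z r 1) dl; rewrite add0r.
Qed.

End Affine.

Section Arcs.
Variables (R : realType) (M : manifold R) (h : riemannian M).
Implicit Types (x y : M) (g : R -> M) (c : chart R M (mdim M)).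

(** The squared speed has zero derivative on [0, t], so the mean value theorem makes its values at
    the endpoints agree. *)
Lemma geodesic_speed g (e t : R) : 0 < e ->
  (forall r, - e < r < 1 + e -> geodesic_at h g r) -> 0 <= t <= 1 ->
  tnorm h (g t) (velocity g t) = tnorm h (g 0) (velocity g 0).
Proof.
move=> e0 geo /andP[t0 t1].
pose f r := inner h (g r) (velocity g r) (velocity g r).
suff f_cst : f t = f 0 by rewrite /tnorm -/(f t) f_cst.
apply/eqP; rewrite -subr_eq0; apply/eqP.
have df r : 0 <= r <= t -> is_derive r 1 f 0.
  by move=> rt; apply: (geodesic_speed_derive geo); lra.
have [||c _] := MVT_segment (f := f) (df := cst 0) t0.
- by move=> r; rewrite in_itv /= => rt; apply: df; lra.
- apply: derivable_within_continuous => r; rewrite in_itv /= => rt.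
  by have [] := df r rt.
- by rewrite mul0r.
Qed.

(** The change of parameter runs from [g 1] back to [g s], matching curves for [dist h (g 1)]. Since
    0 <= s < 1 it maps the interval from - e to 1 + e into itself, so the same margin serves. *)
Lemma reversed_geodesic_C1_arc g (e s : R) : 0 < e -> 0 <= s < 1 ->
  (forall r, - e < r < 1 + e -> geodesic_at h g r) ->
  C1_arc (fun r => g (1 + (s - 1) * r)).
Proof.
move=> e0 s01 geo; exists e => // t te.
have dom r : - e < r < 1 + e -> - e < 1 + (s - 1) * r < 1 + e by nra.
have [g_cont geoc] := geo _ (dom _ te).
have gr_cont : {for t, continuous (fun r => g (1 + (s - 1) * r))}.
  exact: (continuous_comp (@affine_continuous R 1 (s - 1) t) g_cont).
split=> // c Ac ct; have [du du' _] := geoc c Ac ct.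
have dF : \forall r \near t, derivable (fun r => c (g r)) (1 + (s - 1) * r) 1.
  near=> r.
  have cr : chart_dom c (g (1 + (s - 1) * r)).
    by near: r; exact: (gr_cont _ (chart_near ct)).
  have rt : - e < r < 1 + e by near: r; exact: near_itv.
  by have [_ /(_ c Ac cr)[dur _ _]] := geo _ (dom _ rt).
split; first exact: (derivable_affine (F := fun r => c (g r)) (nbhs_singleton dF)).
apply: (derive_affine_continuous (F := fun r => c (g r)) dF).
(* Being a geodesic includes a second derivative, so the first one is continuous. *)
by apply: differentiable_continuous; exact/derivable1_diffP.
Unshelve. all: by end_near. Qed.

(** The velocity is scaled by s - 1 and a geodesic has constant speed, so the integrand is
    constant. *)
Lemma reversed_geodesic_length g (e s : R) : 0 < e -> 0 <= s < 1 ->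
  (forall r, - e < r < 1 + e -> geodesic_at h g r) ->
  arc_length h (fun r => g (1 + (s - 1) * r)) =
  (1 - s) * tnorm h (g 0) (velocity g 0).
Proof.
move=> e0 s01 geo; apply: Rintegral01_cst => r r01.
have r01' : 0 <= 1 + (s - 1) * r <= 1 by nra.
have [|_ geoc] := geo (1 + (s - 1) * r); first by lra.
have [du _ _] := geoc _ (chart_at_atlas _) (chart_at_dom _).
have -> : velocity (fun r => g (1 + (s - 1) * r)) r
    = (s - 1) *: velocity g (1 + (s - 1) * r).
  exact: (derive_affine (F := fun r' => chart_at (g (1 + (s - 1) * r)) (g r')) du).
rewrite -(geodesic_speed e0 geo r01') /tnorm /inner /metric_form.
rewrite -!scalemxAl linearZ -!scalemxAr scalerA mxE -expr2 sqrtrM ?sqr_ge0//.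
by rewrite sqrtr_sqr ler0_norm ?opprB//; lra.
Qed.

Section Segment.
Variables (c : chart R M (mdim M)) (z d : 'rV[R]_(mdim M)).
Hypothesis Ac : atlas M c.

Lemma segment_transition c' r : atlas M c' -> chart_cod c (z + r *: d) ->
  chart_dom c' (chart_inv c (z + r *: d)) ->
  is_derive r 1 (fun r' => c' (chart_inv c (z + r' *: d)))
    ('D_d (fun z' => c' (chart_inv c z')) (z + r *: d)).
Proof.
move=> Ac' cz c'z; have dl := is_derive_line z d r.
have dtau := transition_differentiable Ac Ac' cz c'z.
split.
  exact: (@derivable_comp_curve _ _ _ (fun z' => c' (chart_inv c z'))).
rewrite (@derive_comp_curve _ _ _ (fun z' => c' (chart_inv c z')))//.
by rewrite derive_val deriveE.
Qed.

Lemma line_continuous r : {for r, continuous (fun r' : R => z + r' *: d)}.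
Proof.
by apply: differentiable_continuous; apply/derivable1_diffP; have [] := is_derive_line z d r.
Qed.

Lemma segment_continuous r : chart_cod c (z + r *: d) ->
  {for r, continuous (fun r' : R => chart_inv c (z + r' *: d))}.
Proof.
by move=> cz; exact: (cvg_comp _ _ (line_continuous (r := r)) (chart_inv_cont cz)).
Qed.

(** Read in another chart, the segment has as derivative the derivative of the transition map along
    [d], which is continuous by smoothness of transitions. *)
Lemma segment_C1_arc (e : R) : 0 < e ->
  (forall r, - e < r < 1 + e -> chart_cod c (z + r *: d)) ->
  C1_arc (fun r => chart_inv c (z + r *: d)).
Proof.
move=> e0 cod; exists e => // t te; have cz := cod _ te.
have s_cont := segment_continuous cz.
split=> // c' Ac' c't; split; first by have [] := segment_transition Ac' cz c't.
have nearE : \forall r \near t, 'D_d (fun z' => c' (chart_inv c z')) (z + r *: d)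
    = 'D_1 (fun r' : R => c' (chart_inv c (z + r' *: d))) r.
  near=> r.
  have cr : chart_cod c (z + r *: d) by apply: cod; near: r; exact: near_itv.
  have c'r : chart_dom c' (chart_inv c (z + r *: d)).
    by near: r; exact: (s_cont _ (chart_near c't)).
  by have [_ ->] := segment_transition Ac' cr c'r.
rewrite /prop_for /continuous_at -(nbhs_singleton nearE).
apply: cvg_trans; first exact: (near_eq_cvg nearE).
have tau_cont := smooth_on_derive_continuous (v := d) (atlas_compat Ac Ac') (conj cz c't).
exact: (cvg_comp _ _ (line_continuous (r := t)) tau_cont).
Unshelve. all: by end_near. Qed.

Lemma segment_speed r : chart_cod c (z + r *: d) ->
  let g r' := chart_inv c (z + r' *: d) in
  tnorm h (g r) (velocity g r) =
  Num.sqrt (metric_form (gram_in (metric_mx h) c (z + r *: d)) d d).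
Proof.
move=> cz /=; have nearE : \forall r' \near r, z + r' *: d = c (chart_inv c (z + r' *: d)).
  near=> r'; rewrite chart_invK//; near: r'.
  exact: (line_continuous (chart_cod_near cz)).
have dcg := near_eq_is_derive nearE (is_derive_line z d r).
rewrite /tnorm (inner_velocity h Ac)//; last 2 first.
- exact: chart_invP.
- exact: segment_continuous.
by rewrite derive_val chart_invK.
Unshelve. all: by end_near. Qed.

Lemma segment_length_le (B : R) :
  (forall r, 0 <= r <= 1 -> chart_cod c (z + r *: d) /\
     metric_form (gram_in (metric_mx h) c (z + r *: d)) d d <= B) ->
  arc_length h (fun r => chart_inv c (z + r *: d)) <= Num.sqrt B.
Proof.
move=> segB; apply: Rintegral01_le => r /segB[cz le_B].
by rewrite tnorm_ge0 segment_speed//= ler_wsqrtr.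
Qed.

End Segment.

End Arcs.

(** * The gradient of the squared distance *)

(** The chord [d] from the curve point [u s] to u 0 + s v equals s (v - u'(0)) + o(s). The range -1
    < r < 2 leaves room around [0, 1], as a [C1_arc] requires. *)
Lemma chord_near (R : realType) (V : normedModType R) (u : R -> V) (v : V)
    (A B : set V) : derivable u 0 1 -> nbhs (u 0) A -> nbhs (v - 'D_1 u 0) B ->
  \forall s \near 0^'+, let d := u 0 + s *: v - u s in
    (forall r, -1 < r < 2 -> A (u s + r *: d)) /\ B (s^-1 *: d).
Proof.
move=> du uA vB; have /nbhs_normP[rho /= rho0 rhoA] := uA.
have u_cont : u s @[s --> 0^'+] --> u 0.
  apply: cvg_at_right_filter.
  by apply: differentiable_continuous; exact/derivable1_diffP.
have sv_cvg : (s *: v) @[s --> 0^'+] --> (0 : V).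
  by rewrite -(scale0r v); apply: cvg_at_right_filter; exact: scalel_continuous.
have quot_cvg : (s^-1 *: (u s - u 0)) @[s --> 0^'+] --> 'D_1 u 0.
  have /(cvg_dnbhs_at_right (p := 0)) : (h^-1 *: ((u \o shift 0) (h *: 1) - u 0)) @[h --> 0^'] --> 'D_1 u 0.
    exact: du.
  by under eq_fun do rewrite /= addr0 [_%:A]mulr1.
near=> s.
have s0 : 0 < s by near: s; exact: nbhs_right_gt.
(* A chord point differs from [u 0] by a combination of u s - u 0 and s v with coefficients below 2
   in absolute value, hence by less than 4 rho / 6. *)
have us : `|u s - u 0| < rho / 6.
  by near: s; apply: cvgr_distC_lt u_cont _ _; rewrite divr_gt0.
have sv : `|s *: v| < rho / 6.
  by near: s; apply: cvgr0_norm_lt sv_cvg _ _; rewrite divr_gt0.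
split=> [r r12|].
  apply: rhoA => /=.
  have -> : u 0 - (u s + r *: (u 0 + s *: v - u s)) =
      (r - 1) *: (u s - u 0) - r *: (s *: v).
    have -> : u 0 + s *: v - u s = s *: v - (u s - u 0).
      by rewrite opprB addrA [s *: v + _]addrC.
    rewrite opprD addrA -(opprB (u s)) scalerBr [- (r *: _ - _)]opprB addrA scalerBl scale1r.
    by rewrite [- _ + _]addrC.
  apply: le_lt_trans (ler_normB _ _) _; rewrite [X in X + _]normrZ [X in _ + X]normrZ.
  have : `|r - 1| < 2 by rewrite ltr_norml; lra.
  have : `|r| < 2 by rewrite ltr_norml; lra.
  have := normr_ge0 (u s - u 0); have := normr_ge0 (s *: v).
  have := normr_ge0 (r - 1); have := normr_ge0 r.
  move: us sv; clear; nra.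
have -> : s^-1 *: (u 0 + s *: v - u s) = v - s^-1 *: (u s - u 0).
  rewrite scalerBr scalerDr scalerA mulVf ?gt_eqF// scale1r scalerBr opprB.
  by rewrite addrAC addrC addrCA addrA.
near: s.
have cv : (v - s^-1 *: (u s - u 0)) @[s --> 0^'+] --> v - 'D_1 u 0.
  by apply: cvgB => //; exact: cvg_cst.
exact: (cv _ vB).
Unshelve. all: by end_near. Qed.

(** The form is jointly continuous in base point and vector, being a polynomial in the coordinates
    of the vector and the entries of [G]. *)
Lemma metric_form_near (R : realType) (V : normedModType R) n (G : V -> 'M[R]_n)
    (p : V) (q : 'rV[R]_n) (eta : R) :
  (forall i j, {for p, continuous (fun z => G z i j)}) -> 0 < eta ->
  exists A B, [/\ nbhs p A, nbhs q B & forall z d, A z -> B d ->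
    metric_form (G z) d d <= metric_form (G p) q q + eta].
Proof.
move=> G_cont eta0.
have cv : (metric_form (G zd.1) zd.2 zd.2) @[zd --> (p, q)] --> metric_form (G p) q q.
  under eq_fun do rewrite metric_formE.
  rewrite metric_formE; apply: cvg_big => [|i _]; first exact: add_continuous.
  apply: cvg_big => [|j _]; first exact: add_continuous.
  have coord k : (zd : V * 'rV[R]_n).2 0 k @[zd --> (p, q)] --> q 0 k.
    apply: (@cvg_comp _ _ _ snd (fun d : 'rV[R]_n => d 0 k)); first exact: cvg_snd.
    exact: coord_continuous.
  apply: cvgM => //; apply: cvgM => //.
  apply: (@cvg_comp _ _ _ fst (fun z => G z i j)); first exact: cvg_fst.
  exact: G_cont.
have /(cvgr_lt _ cv) : metric_form (G p) q q < metric_form (G p) q q + eta.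
  by rewrite ltrDl.
move=> [[A B] /= [pA qB] AB]; exists A, B; split=> // z d Az Bd.
exact: ltW (AB (z, d) (conj Az Bd)).
Qed.

Section Gradient.
Variables (R : realType) (M : manifold R) (h : riemannian M).
Implicit Types (x y : M) (g : R -> M) (c : chart R M (mdim M)).

(** The comparison curve follows the geodesic back from [g 1] to [g s], then a chart segment. Its
    two pieces have length (1 - s) |g'(0)| and at most s times the root of [B]; convexity of the
    square concludes. *)
Lemma dist_sqr_chord g (e : R) c (s e' B : R) (d : 'rV[R]_(mdim M)) :
  0 < e -> (forall r, - e < r < 1 + e -> geodesic_at h g r) ->
  atlas M c -> 0 < s < 1 -> chart_dom c (g s) -> 0 < e' ->
  (forall r, - e' < r < 1 + e' -> chart_cod c (c (g s) + r *: d)) ->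
  (forall r, 0 <= r <= 1 ->
     metric_form (gram_in (metric_mx h) c (c (g s) + r *: d)) (s^-1 *: d) (s^-1 *: d) <= B) ->
  dist h (g 1) (chart_inv c (c (g s) + d)) ^+ 2 <=
    (1 - s) * inner h (g 0) (velocity g 0) (velocity g 0) + s * B.
Proof.
move=> e0 geo Ac s01 cgs e'0 cod le_B.
have s0 : s != 0 by rewrite gt_eqF//; lra.
have s01' : 0 <= s < 1 by lra.
set z := c (g s) in cod le_B *.
have formE r : metric_form (gram_in (metric_mx h) c (z + r *: d)) d d =
    s ^+ 2 * metric_form (gram_in (metric_mx h) c (z + r *: d)) (s^-1 *: d) (s^-1 *: d).
  rewrite /metric_form -!scalemxAl linearZ -!scalemxAr scalerA [in RHS]mxE.
  by field.
have B0 : 0 <= B.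
  have := le_B 0; rewrite lexx ler01 => /(_ isT); apply: le_trans.
  by rewrite gram_formE inner_ge0.
have seg_le : arc_length h (fun r => chart_inv c (z + r *: d)) <= s * Num.sqrt B.
  have -> : s * Num.sqrt B = Num.sqrt (s ^+ 2 * B).
    by rewrite sqrtrM ?sqr_ge0// sqrtr_sqr gtr0_norm//; lra.
  apply: segment_length_le => // r r01; split; first by apply: cod; lra.
  by rewrite formE ler_wpM2l ?sqr_ge0// le_B.
have joined : joined_by_length h (g 1) (chart_inv c (z + d))
    (arc_length h (fun r => g (1 + (s - 1) * r)) +
     (arc_length h (fun r => chart_inv c (z + r *: d)) + 0)).
  apply: (joined_arc (z := g s)).
  - exact: (reversed_geodesic_C1_arc e0 s01' geo).
  - by rewrite mulr0 addr0.
  - by rewrite mulr1 addrC subrK.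
  apply: (joined_arc (z := chart_inv c (z + d))); last exact: joined_refl.
  - exact: (segment_C1_arc Ac e'0 cod).
  - by rewrite scale0r addr0 chart_mapK.
  - by rewrite scale1r.
have dle : dist h (g 1) (chart_inv c (z + d)) <=
    (1 - s) * tnorm h (g 0) (velocity g 0) + s * Num.sqrt B.
  apply: (le_trans (dist_le joined)).
  rewrite (reversed_geodesic_length e0 s01' geo) (addr0 (arc_length h _)).
  by rewrite lerD2l.
rewrite -tnorm_sqr; move: (tnorm _ _ _) dle => L dle.
have -> : B = Num.sqrt B ^+ 2 by rewrite sqr_sqrtr.
move: dle (dist_ge0 h (g 1) (chart_inv c (z + d))) (sqrtr_ge0 B) s01.
move: (dist _ _ _) (Num.sqrt B) => D b Dle D0 b0 s01.
have : D ^+ 2 <= ((1 - s) * L + s * b) ^+ 2.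
  by rewrite ler_pXn2r ?nnegrE//; exact: le_trans Dle.
(* This is the convexity defect (1 - s) L^2 + s b^2 - ((1 - s) L + s b)^2. *)
have : 0 <= s * (1 - s) * (L - b) ^+ 2 by rewrite mulr_ge0 ?sqr_ge0//; nra.
nra.
Qed.

End Gradient.

Lemma eq0_of_quadratic_bound (R : realFieldType) (a b : R) : 0 <= b ->
  (forall t, t * a <= t ^+ 2 * b) -> a = 0.
Proof.
move=> b0 le_ab; have b1 : 0 < b + 1 by lra.
(* Here the bound reads a^2 / (b + 1) <= a^2 b / (b + 1)^2, whose right side minus left side is - (a
   / (b + 1))^2. Adding 1 keeps the denominator positive when b = 0. *)
have := le_ab (a / (b + 1)).
rewrite mulrAC -expr2 exprMn exprVn -subr_ge0.
have -> : a ^+ 2 * (b + 1) ^- 2 * b - a ^+ 2 / (b + 1) = - (a / (b + 1)) ^+ 2.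
  by field; rewrite gt_eqF.
rewrite oppr_ge0 => le0; apply/eqP.
have : (a / (b + 1)) ^+ 2 == 0 by rewrite eq_le le0 sqr_ge0.
by rewrite sqrf_eq0 mulf_eq0 invr_eq0 (gt_eqF b1) orbF.
Qed.

Section Gradient.
Variables (R : realType) (M : manifold R) (h : riemannian M).
Implicit Types (x y : M) (g : R -> M) (c : chart R M (mdim M)).

Lemma innerZl x a v w : inner h x (a *: v) w = a * inner h x v w.
Proof. by rewrite /inner /metric_form -!scalemxAl mxE. Qed.

Lemma innerBl x v v' w : inner h x (v - v') w = inner h x v w - inner h x v' w.
Proof. by rewrite /inner /metric_form !mulmxBl !mxE. Qed.

Lemma inner_eq0 x v : inner h x v v = 0 -> v = 0.
Proof. by apply: contra_eq => /(metric_pos h x); rewrite lt0r => /andP[]. Qed.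

Lemma gram_form_preferred x v w :
  metric_form (gram_in (metric_mx h) (chart_at x) (chart_at x x)) v w = inner h x v w.
Proof. by rewrite gram_formE coord_mx_preferred !mulmx1 (chart_mapK (chart_at_dom x)). Qed.

Lemma gram_continuous c z i j : atlas M c -> chart_cod c z ->
  {for z, continuous (fun z' => gram_in (metric_mx h) c z' i j)}.
Proof.
move=> Ac cz; apply: differentiable_continuous.
exact: (smooth_on_differentiable (metric_smooth h Ac i j) cz).
Qed.

Lemma diff_dist_sqr_le g (e : R) (v : tangent R M) :
  let x := g 0 in let w := velocity g 0 in
  let f := fun z => dist h (g 1) (chart_inv (chart_at x) z) ^+ 2 in
  0 < e -> (forall r, - e < r < 1 + e -> geodesic_at h g r) ->
  tnorm h x w = dist h (g 1) x ->
  differentiable f (chart_at x x) ->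
  'd f (chart_at x x) v <= inner h x v v - 2 * inner h x w v.
Proof.
move=> x w f e0 geo dist_w df.
set c := chart_at x in f df *; set p := c x in df *.
have Ac : atlas M c := chart_at_atlas x.
have cx : chart_dom c x := chart_at_dom x.
have cp : chart_cod c p := chart_mapP cx.
have geo0 : geodesic_at h g 0 by apply: geo; lra.
have [g_cont /(_ c Ac cx)[du _ _]] := geo0.
pose u r := c (g r).
have du0 : derivable u 0 1 := du.
apply/ler_addgt0Pr => eta eta0.
(* The slack [eta] absorbs both the variation of the metric along the chord and the deviation of d /
   s from its limit. *)
have [A [B [pA vB AB]]] := metric_form_near (v - 'D_1 u 0)
  (fun i j => gram_continuous (i := i) (j := j) Ac cp) eta0.
have chord := chord_near du0 (filterI (pA : nbhs (u 0) A) (chart_cod_near cp)) vB.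
apply: (diff_le_right df); near=> s.
have s0 : 0 < s by near: s; exact: nbhs_right_gt.
have s1 : s < 1 by near: s; exact: nbhs_right_lt.
have cgs : chart_dom c (g s).
  near: s; have := cvg_at_right_filter g_cont; apply; exact: chart_near.
have [Acod Bd] : (forall r, -1 < r < 2 -> (A `&` chart_cod c) (u s + r *: (u 0 + s *: v - u s)))
    /\ B (s^-1 *: (u 0 + s *: v - u s)) by near: s; exact: chord.
have s01 : 0 < s < 1 by rewrite s0.
have cod r : - 1 < r < 1 + 1 -> chart_cod c (c (g s) + r *: (u 0 + s *: v - u s)).
  by move=> r12; have [|_] := Acod r _; first lra.
have le_B r : 0 <= r <= 1 ->
    metric_form (gram_in (metric_mx h) c (c (g s) + r *: (u 0 + s *: v - u s)))
      (s^-1 *: (u 0 + s *: v - u s)) (s^-1 *: (u 0 + s *: v - u s)) <=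
    metric_form (gram_in (metric_mx h) c p) (v - 'D_1 u 0) (v - 'D_1 u 0) + eta.
  by move=> r01; apply: (AB _ _ _ Bd); have [|] := Acod r _; first lra.
have := dist_sqr_chord e0 geo Ac s01 cgs ltr01 cod le_B.
(* The chord ends at the point with coordinates p + s v, where [f] is to be bounded. *)
rewrite [c (g s) + _]addrC subrK gram_form_preferred => le_f.
apply: le_trans le_f _; rewrite /f (chart_mapK cx) -dist_w tnorm_sqr.
(* As [c] is the preferred chart at [g 0], the derivative of [u] at 0 is [w] by definition. *)
rewrite -/w -[X in inner h x X X]/(v - w) innerBl !(innerC h x _ (v - w)) !innerBl.
rewrite (innerC h x v w).
rewrite le_eqVlt; apply/orP; left; apply/eqP; ring.
Unshelve. all: by end_near. Qed.

(** The upper bound at [t *: v] reads t (D v + 2 <w, v>) <= t^2 |v|^2 for all real [t] of either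
    sign, which forces the linear coefficient to vanish. *)
Lemma diff_dist_sqr x y w v : ~ cut_locus h y x -> shortest h x y w ->
  'd (fun z => dist h y (chart_inv (chart_at x) z) ^+ 2) (chart_at x x) v =
  - 2 * inner h x w v.
Proof.
move=> /contrapT df [[g [[e e0 geo] [gx gw gy]]] dist_w].
move: df dist_w; rewrite /mdifferentiable -gx -gy -gw => df dist_w.
have {}le_diff := fun v => @diff_dist_sqr_le g e v e0 geo dist_w df.
move: le_diff; set D := 'd _ _ => le_diff.
suff : D v + 2 * inner h (g 0) (velocity g 0) v = 0.
  by move=> /eqP; rewrite addr_eq0 mulNr => /eqP.
apply: (eq0_of_quadratic_bound (inner_ge0 h (g 0) v)) => t.
have tD : D (t *: v) = t * D v by exact: linearZ.
have := le_diff (t *: v).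
rewrite tD innerZl !(innerC h _ _ (t *: v)) !innerZl (innerC h _ v (velocity g 0)).
move: (inner _ _ _ _) (inner _ _ _ _) (D v); clear.
move=> a b d; nra.
Qed.

(** Two shortest vectors [w] and [w'] represent the same differential; evaluating it at w' - w gives
    |w' - w|^2 = 0. So a unique shortest vector exists and [log] does not fall back on its default
    0. *)
Lemma log_shortest x y : shortest_exist h -> ~ cut_locus h y x ->
  shortest h x y (log h x y).
Proof.
move=> ex_log ncut; have [w sw] := ex_log y x ncut.
suff uniq w' : shortest h x y w' -> w' = w.
  by rewrite /log; case: xgetP => [_ _ [] //|/(_ w)[]]; split.
move=> sw'; apply/eqP; rewrite -subr_eq0; apply/eqP/(inner_eq0 (x := x)).
have := diff_dist_sqr (w' - w) ncut sw'; rewrite (diff_dist_sqr (w' - w) ncut sw).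
by rewrite innerBl => /(mulfI _) ->; rewrite ?subrr// oppr_eq0 pnatr_eq0.
Qed.

End Gradient.

(** * Evaluation along a parametrised submanifold *)

Section NearDiff.
Variables (R : realType) (V W : normedModType R).

(** The first-order expansion of [f] at [x] is also one of [g], with the same linear part. *)
Lemma near_eq_differentiable (f g : V -> W) (x : V) :
  (\forall x' \near x, f x' = g x') -> differentiable f x -> differentiable g x.
Proof.
move=> fg df; have [dfc dfE] := (diff_locallyP x f).1 df.
have fgx : f x = g x := nbhs_singleton fg.
have shift_cvg : (h + x) @[h --> (0 : V)] --> x.
  rewrite -[X in _ --> X]add0r; apply: cvgD; first exact: cvg_id.
  exact: cvg_cst.
have dgE : g \o shift x = cst (g x) + 'd f x +o_ (0 : V) id.
  move/eqaddoP : dfE => dfE; apply/eqaddoP => eps eps0.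
  near=> h; have gh : g (h + x) = f (h + x).
    by apply/esym; near: h; exact: shift_cvg fg.
  have : `|(f \o shift x - (cst (f x) + 'd f x)) h| <= eps * `|h|.
    by near: h; exact: dfE.
  by rewrite -fgx -[X in `|X|]/(f (h + x) - _) -[X in _ -> `|X| <= _]/(g (h + x) - _) gh.
by apply/diff_locallyP; rewrite (diff_unique dfc dgE).
Unshelve. all: by end_near. Qed.

Lemma near_eq_diff (f g : V -> W) (x v : V) :
  (\forall x' \near x, f x' = g x') -> differentiable f x -> 'd g x v = 'd f x v.
Proof.
move=> fg df; rewrite -!deriveE//; last exact: near_eq_differentiable fg df.
by apply/esym; exact: near_eq_derive.
Qed.

End NearDiff.

Section Evaluation.
Variables (R : realType) (M N : manifold R) (m : nat).
Variables (G : set (smoothMap M N)) (gam : smoothMap M N).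
Variables (U : set 'rV[R]_m) (phi : 'rV[R]_m -> smoothMap M N) (u : 'rV[R]_m).
Hypothesis par : local_param G gam U phi u.

Lemma param_eval_near t (d : chart R N (mdim N)) : chart_dom d (gam t) ->
  \forall u' \near u, chart_dom d (phi u' t).
Proof.
case: par => -[_ Uu phiu] [[phi_cont _] _ _ _ _] dt.
have pair_cvg : (u', t) @[u' --> u] --> (u, t).
  exact: (@cvg_pair _ _ _ (nbhs u) (nbhs u) (nbhs t) _ _ _ id (fun=> t) (@cvg_id _ _) (@cvg_cst _ t _ _ _)).
have dphi : \forall x \near phi u t, chart_dom d x by apply: chart_near; rewrite phiu.
exact: (pair_cvg _ (phi_cont u t Uu _ dphi)).
Qed.

(** The family is jointly smooth in charts; composing with the affine slice that fixes the second
    coordinate at [c t] isolates the parameter. *)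
Lemma param_eval_differentiable t : let d := chart_at (gam t) in
  differentiable (fun u' => d (phi u' t)) u.
Proof.
case: par => -[_ Uu phiu] [[_ phi_smooth] _ _ _ _] d.
set c := chart_at t : chart R M (mdim M).
have ct : chart_dom c t by exact: chart_at_dom.
have smo := phi_smooth c d (chart_at_atlas t) (chart_at_atlas (gam t)).
have dF : differentiable (fun p => d (phi p.1 (chart_inv c p.2))) (u, c t).
  apply: (smooth_on_differentiable smo); split=> //=; first exact: chart_mapP.
  by rewrite chart_mapK// phiu; exact: chart_at_dom.
have dpair : differentiable (fun u' : 'rV[R]_m => (u', c t)) u.
  exact: differentiable_pair.
have := differentiable_comp dpair dF; congr (differentiable _ _).
by apply/funext => u' /=; rewrite chart_mapK.
Qed.

Lemma family_diff_eval t a : let d := chart_at (gam t) in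
  family_diff phi u a t = 'd (fun u' => d (phi u' t)) u a.
Proof.
case: (par) => -[_ _ phiu] _ d.
rewrite /family_diff /velocity scale0r addr0 phiu -/d.
have dl := is_derive_line u a 0.
have deval := param_eval_differentiable t.
have u0 : u + 0 *: a = u by rewrite scale0r addr0.
rewrite (@derive_comp_curve _ _ _ (fun u' => d (phi u' t)) (fun r => u + r *: a)) ?u0//.
by rewrite derive_val.
Qed.

(** The embedding condition applied to [U] itself places its whole image in [G]. *)
Lemma param_in_near : \forall u' \near u, G (phi u').
Proof.
case: par => -[Uopen Uu _] [_ _ _ _ img].
have [W _ phiU] := img U Uopen (@subset_refl _ U).
have : \forall u' \near u, U u' by apply: open_nbhs_nbhs.
apply: filterS => u' Uu'; have : (G `&` W) (phi u') by rewrite -phiU; exists u'.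
by case.
Qed.

Variable h : riemannian N.

(** Near [u] the evaluated point stays in the preferred chart at [gam t], so the squared distance
    factors through it and the chain rule applies to the gradient formula. *)
Lemma dist_sqr_param y t : shortest_exist h -> ~ cut_locus h y (gam t) ->
  differentiable (fun u' => dist h y (phi u' t) ^+ 2) u /\
  forall a, 'd (fun u' => dist h y (phi u' t) ^+ 2) u a =
    - 2 * inner h (gam t) (log h (gam t) y) (family_diff phi u a t).
Proof.
move=> ex_log ncut; set x := gam t in ncut *.
set d := chart_at x : chart R N (mdim N).
pose f z := dist h y (chart_inv d z) ^+ 2.
pose psi u' := d (phi u' t).
have phiu : phi u = gam by case: par => -[].
have dpsi : differentiable psi u := param_eval_differentiable t.
have df : differentiable f (psi u).
  by rewrite /psi phiu; exact: (contrapT ncut).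
have dcomp := differentiable_comp dpsi df.
have fpsi : \forall u' \near u, (f \o psi) u' = dist h y (phi u' t) ^+ 2.
  have := param_eval_near (chart_at_dom x : chart_dom d (gam t)).
  by apply: filterS => u' du'; rewrite /= /f /psi chart_mapK.
split=> [|a]; first exact: near_eq_differentiable fpsi dcomp.
rewrite (near_eq_diff a fpsi dcomp) diff_comp// [LHS]/= family_diff_eval.
rewrite -(diff_dist_sqr _ ncut (log_shortest ex_log ncut)).
by rewrite /psi phiu.
Qed.

End Evaluation.

(** * First-order condition at a minimiser *)

Unset Implicit Arguments.

Theorem proposition3p7 (R : realType) (Theta Lambda : manifold R)
    (h : riemannian Lambda)
    (Lambda_connected : connected [set: Lambda])
    (Lambda_log : shortest_exist h)
    (k : nat) (k_gt0 : (0 < k)%N)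
    (theta : 'I_k -> Theta) (y : 'I_k -> Lambda)
    (m : nat) (Gamma : set (smoothMap Theta Lambda))
    (Gamma_submanifold : submanifold m Gamma)
    (Gamma_compact : compact Gamma)
    (gamma : smoothMap Theta Lambda) (Gamma_gamma : Gamma gamma)
    (gamma_min : forall gamma', Gamma gamma' ->
       mean_sq_dist h theta y gamma <= mean_sq_dist h theta y gamma') :
  (has_differential m Gamma (mean_sq_dist h theta y) gamma
     (mean_sq_dist_form h theta y gamma) /\
   forall v, tangent_space m Gamma gamma v ->
     mean_sq_dist_form h theta y gamma v = 0)
  \/ exists l, cut_locus h (y l) (gamma (theta l)).
Proof.
have [cut|ncut] := pselect (exists l, cut_locus h (y l) (gamma (theta l))).
  by right.
left; have {}ncut l : ~ cut_locus h (y l) (gamma (theta l)).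
  by move=> cut; apply: ncut; exists l.
have diff_s : has_differential m Gamma (mean_sq_dist h theta y) gamma
    (mean_sq_dist_form h theta y gamma).
  move=> U phi u par.
  pose F l u' := dist h (y l) (phi u' (theta l)) ^+ 2.
  have F_diff l := dist_sqr_param par Lambda_log (ncut l).
  have dF l : differentiable (F l) u by have [] := F_diff l.
  (* In the parameter the functional is a multiple of the sum of the [F l], each differentiable off
     the cut locus. *)
  have sE : (fun u' => mean_sq_dist h theta y (phi u')) = k%:R^-1 *: \sum_(l < k) F l.
    by apply/funext => u'; rewrite /mean_sq_dist [in RHS]fctE fct_sumE.
  have dsum := differentiable_sum dF.
  rewrite sE; split=> [|a]; first exact: differentiableZ.
  rewrite diffZ// -[LHS]/(_ * _) -deriveE// derive_sum; last first.
    by move=> l; exact: diff_derivable.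
  rewrite mulr_sumr /mean_sq_dist_form [RHS]mulr_sumr; apply: eq_bigr => l _.
  rewrite deriveE//; have [_ ->] := F_diff l; rewrite /dev_adj /ev /dev.
  by move: (inner _ _ _ _) => b; ring.
(* A tangent vector is the image of some [a] under a local parametrisation [phi]; the form takes on
   it the value at [a] of the differential of the functional along [phi], which has a local minimum
   at [u]. *)
split=> // v [U [phi [u [a [par ->]]]]].
have [ds dsE] := diff_s U phi u par; rewrite -dsE; apply: diff_local_min => //.
have phiu : phi u = gamma by case: par => -[].
apply: filterS (param_in_near par) => u' Gu'; rewrite phiu; exact: gamma_min.
Qed.
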